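(* For all $n\ge3$, the open subset $\Omega(C_n)$ of $\mathbb{R}^{2(n-2)}$ is contractible.
   Context: $C_n$ is the combinatorial type with rays $1,\dots,n$ and maximal cones $\{1,2\},\{2,3\},\dots,\{n-1,n\},\{n,1\}$ (the combinatorial type of a complete fan with $n$ generators in $\mathbb{R}^2$). $\Omega(C_n)\subset(\mathbb{R}^2)^{n-2}$ is the set of $(v_3,\dots,v_n)$ such that, with $v_1=e_1,v_2=e_2$, the collection $\{0\}$, $\mathrm{Cone}(v_i)$ ($1\le i\le n$), $\mathrm{Cone}(v_i,v_{i+1})$ ($1\le i\le n$, indices mod $n$) is a fan of strongly convex cones of $\mathbb{R}^2$ (stable under faces, intersections being common faces) whose combinatorial type, i.e. the poset of subsets $I\subset\{1,\dots,n\}$ such that $\mathrm{Cone}(v_i,i\in I)$ is a cone of the fan generated in this way, is $C_n$. *)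

(* Defs.v *)
From HB Require Import structures.
From mathcomp Require Import all_boot all_order all_algebra.
From mathcomp Require Import all_classical all_reals all_analysis.

Set Implicit Arguments.
Unset Strict Implicit.
Unset Printing Implicit Defensive.

Import Order.TTheory GRing.Theory Num.Theory.
Import numFieldNormedType.Exports.

Local Open Scope classical_set_scope.
Local Open Scope ring_scope.

Definition cone (R : realType) (d n : nat) (v : 'I_n -> 'rV[R]_d)
    (I : {set 'I_n}) : set 'rV[R]_d :=
  [set x | exists2 a : 'I_n -> R,
     forall i, 0 <= a i & x = \sum_(i in I) a i *: v i].

Definition polyhedral_cone (R : realType) (d : nat) (s : set 'rV[R]_d) : Prop :=
  exists (k : nat) (w : 'I_k -> 'rV[R]_d), s = cone w (finset.setTfor 'I_k).

Definition strongly_convex (R : realType) (d : nat) (s : set 'rV[R]_d) : Prop :=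
  forall x, s x -> s (- x) -> x = 0.

(* Linear forms on the row space are column vectors [u], acting by [x *m u]. *)
Definition is_face (R : realType) (d : nat) (t s : set 'rV[R]_d) : Prop :=
  exists2 u : 'cV[R]_d,
    forall x, s x -> 0 <= (x *m u) 0 0 &
    t = s `&` [set x | (x *m u) 0 0 = 0].

Definition is_fan (R : realType) (d : nat) (F : set (set 'rV[R]_d)) : Prop :=
  [/\ finite_set F,
      F !=set0,
      forall s, F s -> polyhedral_cone s /\ strongly_convex s,
      forall s t, F s -> is_face t s -> F t &
      forall s t, F s -> F t -> is_face (s `&` t) s /\ is_face (s `&` t) t].

(* The cone over the empty set of indices is {0}. *)
Definition generated_cones (R : realType) (d n : nat) (v : 'I_n -> 'rV[R]_d)
    (C : {set {set 'I_n}}) : set (set 'rV[R]_d) :=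
  [set cone v I | I in [set I | I \in C]].

Definition has_combinatorial_type (R : realType) (d n : nat)
    (F : set (set 'rV[R]_d)) (v : 'I_n -> 'rV[R]_d) (C : {set {set 'I_n}}) :
    Prop :=
  forall I : {set 'I_n}, F (cone v I) <-> I \in C.

(* Rays are numbered from 0, and [ordS] is the successor modulo n.  The members
   are the faces of the maximal cones, i.e. the empty set, the {i} and the
   {i, i+1}. *)
Definition cycle_type (n : nat) : {set {set 'I_n}} :=
  finset.finset (fun I : {set 'I_n} =>
    [exists i : 'I_n, I \subset [set i; ordS i]%SET]).

(* e_1, e_2 followed by the n - 2 rows of [w]; the default value 0 is never
   used when 2 <= n. *)
Definition normalized_rays (R : realType) (n : nat) (w : 'M[R]_(n - 2, 2)) :
    'I_n -> 'rV[R]_2 :=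
  fun i => nth 0 [:: delta_mx 0 0, delta_mx 0 1
                   & [seq row k w | k <- enum 'I_(n - 2)]] i.

(* (R^2)^(n-2) is the space of matrices with n - 2 rows in R^2. *)
Definition Omega (R : realType) (n : nat) (C : {set {set 'I_n}}) :
    set 'M[R]_(n - 2, 2) :=
  [set w | let v := normalized_rays w in
           is_fan (generated_cones v C) /\
           has_combinatorial_type (generated_cones v C) v C].
Arguments Omega R {n} C.

(* The subspace [A] is contractible: its identity map is homotopic, inside [A],
   to a constant map; in particular [A] is nonempty. *)
Definition contractible (R : realType) (T : topologicalType) (A : set T) :
    Prop :=
  exists2 a : T, A a &
    exists H : R * T -> T,
      [/\ {within `[0, 1] `*` A, continuous H},
          forall z, (`[0, 1] `*` A) z -> A (H z),
          forall x, A x -> H (0, x) = x &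
          forall x, A x -> H (1, x) = a].
Arguments contractible R {T} A.

(* Main.v *)
Require Import Defs.
From HB Require Import structures.
From mathcomp Require Import all_boot all_order all_algebra.
From mathcomp Require Import all_classical all_reals all_analysis.
From mathcomp Require Import ring lra.

Set Implicit Arguments.
Unset Strict Implicit.
Unset Printing Implicit Defensive.

Import Order.TTheory GRing.Theory Num.Theory.
Import numFieldNormedType.Exports.

Local Open Scope classical_set_scope.
Local Open Scope ring_scope.

(** Write [D(x, y)] for the determinant of two vectors of the plane, and
    [v_0 = e_1, v_1 = e_2, v_2, ..., v_(n-1)] for the rays.

    The fan condition is a condition on signs of determinants: [w] is in
    [Omega] if and only if all [D(v_j, v_(j+1))] are positive (indices modulo
    [n]) and no [v_i] lies in the closed sector from [v_j] to [v_(j+1)] unless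
    [i] is [j] or [j+1] ([Omega_cycleE]).  A fan gives these signs because a
    generator which lies in a cone of the fan belongs to its index set
    ([cone_in_cycle_type]); this excludes zero and repeated rays, strong
    convexity excludes opposite ones in a cone, and the same argument
    propagates the orientation of [(e_1, e_2)] around the cycle
    ([ccw_of_fan]).  Conversely, two sectors narrower than a half-turn which
    meet outside the origin are such that one contains the first ray of the
    other, so the sign conditions only let consecutive sectors meet, along
    their common ray ([ccw_overlap]); the other fan axioms follow from the
    existence of linear forms that cut out every face ([ccw_is_fan]).  Each
    condition is a strict inequality between polynomials, or a disjunction of
    two of them, so [Omega] is open.

    For contractibility, let [theta] be the angle of a vector [x] that is not
    on the ray of [e_1], and put [t = cot (theta / 2)] and [r = |x| - x_0].
    Then [x = (r (t^2 - 1) / 2, r t)], and these coordinates identify the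
    complement of the ray with the half-plane [r > 0].  Moreover the
    determinant of the vectors of coordinates [(r, t)] and [(q, s)] is
    [r q / 2 * (t - s) (t s + 1)].  In these coordinates [Omega] becomes the
    set of sequences with [r_i > 0] and
      [1 = t_1 > t_2 > ... > t_(n-1)],  [t_i t_(i+1) > -1],  [t_(n-1) < 0]
    ([ccw_cot_chain]): the first condition orders the angles in one turn, the
    other two bound the consecutive differences by a half-turn.  This set is
    not convex in general, but it is star-shaped with respect to any of its
    points for which [-1 <= t_i < 0] when [i > 1] ([cot_chain_interpolate]);
    one of them has [t_i = - (i - 1) / n] for [i > 1].  The contraction moves
    every [(r_i, t_i)] with [i > 1] to [(1, - (i - 1) / n)] along a segment. *)

(** * Cones in general *)

Lemma cone_sub (R : realType) (d n : nat) (v : 'I_n -> 'rV[R]_d)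
    (I J : {set 'I_n}) :
  (forall i, i \in I -> cone v J (v i)) -> cone v I `<=` cone v J.
Proof.
move=> IJ x [a a0 ->].
elim/big_rec: _ => [|i y iI [b b0 ->]].
  by exists (fun=> 0) => //; rewrite big1// => i _; rewrite scale0r.
have [c c0 ->] := IJ i iI.
exists (fun j => a i * c j + b j) => [j|].
  by rewrite addr_ge0// mulr_ge0.
rewrite scaler_sumr -big_split/=; apply: eq_bigr => j _.
by rewrite scalerDl scalerA.
Qed.

Lemma cone_gen (R : realType) (d n : nat) (v : 'I_n -> 'rV[R]_d)
    (I : {set 'I_n}) (i : 'I_n) : i \in I -> cone v I (v i).
Proof.
move=> iI; exists (fun j => (j == i)%:R) => [j|]; first by case: (j == i).
rewrite (bigD1 i)//= eqxx scale1r big1 ?addr0// => j /andP[_ /negPf->].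
by rewrite scale0r.
Qed.

Lemma cone0 (R : realType) (d n : nat) (v : 'I_n -> 'rV[R]_d)
    (I : {set 'I_n}) : cone v I 0.
Proof.
by exists (fun=> 0) => //; rewrite big1// => i _; rewrite scale0r.
Qed.

Lemma coneS (R : realType) (d n : nat) (v : 'I_n -> 'rV[R]_d)
    (I J : {set 'I_n}) : I \subset J -> cone v I `<=` cone v J.
Proof. by move=> /fintype.subsetP IJ; apply: cone_sub => i /IJ; apply: cone_gen. Qed.

Lemma polyhedral_cone_cone (R : realType) (d n : nat) (v : 'I_n -> 'rV[R]_d)
    (I : {set 'I_n}) : polyhedral_cone (cone v I).
Proof.
exists n, (fun i => if i \in I then v i else 0); apply/seteqP; split.
- move=> x [a a0 ->]; exists a => //; rewrite big_mkcond/=.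
  rewrite [RHS](eq_bigl predT) => [|i]; last by rewrite finset.in_setT.
  by apply: eq_bigr => i _; case: ifP => // _; rewrite scaler0.
- move=> x [a a0 ->]; exists a => //; rewrite [RHS]big_mkcond/=.
  rewrite [LHS](eq_bigl predT) => [|i]; last by rewrite finset.in_setT.
  by apply: eq_bigr => i _; case: ifP => // _; rewrite scaler0.
Qed.

(** A sum of nonnegative terms vanishes only if every term does, so a
    supporting hyperplane cuts a cone along the generators that it contains. *)
Lemma cone_ker (R : realType) (d n : nat) (v : 'I_n -> 'rV[R]_d)
    (I : {set 'I_n}) (u : 'cV[R]_d) :
  (forall i, i \in I -> 0 <= (v i *m u) 0 0) ->
  cone v I `&` [set x | (x *m u) 0 0 = 0] =
  cone v (I :&: finset (fun i => (v i *m u) 0 0 == 0))%SET.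
Proof.
move=> u0.
have E (a : 'I_n -> R) (J : {set 'I_n}) : ((\sum_(i in J) a i *: v i) *m u) 0 0 =
    \sum_(i in J) a i * (v i *m u) 0 0.
  rewrite mulmx_suml summxE; apply: eq_bigr => i _.
  by rewrite -scalemxAl mxE.
apply/seteqP; split => x.
- move=> [[a a0 ->]]; rewrite /= E => /eqP.
  rewrite psumr_eq0 => [/allP s0|i iI]; last by rewrite mulr_ge0 ?u0.
  exists a => //; rewrite big_mkcond [RHS]big_mkcond/=; apply: eq_bigr => i _.
  rewrite !inE; case: ifP => //= iI; case: ifP => // ui.
  have := s0 i (mem_index_enum _); rewrite iI/= mulf_eq0 ui orbF => /eqP ->.
  by rewrite scale0r.
- move=> xI; split; first by apply: coneS xI; apply: finset.subsetIl.
  case: xI => a a0 ->; rewrite /= E big1// => i.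
  by rewrite !inE => /andP[_ /eqP->]; rewrite mulr0.
Qed.

Lemma cone_face (R : realType) (d n : nat) (v : 'I_n -> 'rV[R]_d)
    (I : {set 'I_n}) (t : set 'rV[R]_d) :
  is_face t (cone v I) -> exists2 J : {set 'I_n}, J \subset I & t = cone v J.
Proof.
move=> [u u0 ->]; rewrite cone_ker => [|i iI]; last exact/u0/cone_gen.
by eexists; last reflexivity; apply: finset.subsetIl.
Qed.

(** * Determinants of pairs of vectors in the plane *)

Definition det2 (R : realType) (x y : 'rV[R]_2) : R :=
  x 0 0 * y 0 1 - x 0 1 * y 0 0.

Lemma row2P (R : realType) (x y : 'rV[R]_2) :
  x 0 0 = y 0 0 -> x 0 1 = y 0 1 -> x = y.
Proof.
move=> x0 x1; apply/rowP => i.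
have : i = 0 \/ i = 1.
  by case: i => [[|[|//]] h]; [left|right]; apply/val_inj.
by case=> ->.
Qed.

Lemma det2C (R : realType) (x y : 'rV[R]_2) : det2 x y = - det2 y x.
Proof. rewrite /det2; ring. Qed.

Lemma det2xx (R : realType) (x : 'rV[R]_2) : det2 x x = 0.
Proof. rewrite /det2; ring. Qed.

Lemma det2_cramer (R : realType) (a b x : 'rV[R]_2) :
  det2 a b *: x = det2 x b *: a + det2 a x *: b.
Proof. by apply: row2P; rewrite !mxE /det2; ring. Qed.

Lemma det2_eq0 (R : realType) (a b x : 'rV[R]_2) :
  det2 a b != 0 -> det2 a x = 0 -> det2 x b = 0 -> x = 0.
Proof.
move=> ab0 ax xb; have /eqP := det2_cramer a b x.
by rewrite ax xb !scale0r addr0 scaler_eq0 (negPf ab0) => /eqP.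
Qed.

Lemma det2_comb (R : realType) (a b : 'rV[R]_2) (s t : R) :
  (det2 a (s *: a + t *: b) = t * det2 a b) *
  (det2 (s *: a + t *: b) b = s * det2 a b).
Proof. by split; rewrite /det2 !mxE; ring. Qed.

Lemma sum_sub2 (V : zmodType) (n : nat) (F : 'I_n -> V) (I : {set 'I_n})
    (j k : 'I_n) : j != k -> I \subset [set j; k]%SET ->
  \sum_(i in I) F i =
  (if j \in I then F j else 0) + (if k \in I then F k else 0).
Proof.
move=> jk /fintype.subsetP IJ; rewrite big_mkcond/= (bigD1 j)//= (bigD1 k)/=; last first.
  by rewrite eq_sym.
rewrite big1 ?addr0// => i /andP[ij ik]; case: ifP => // /IJ.
by rewrite !inE (negPf ij) (negPf ik).
Qed.

(** Membership in a face of a two-dimensional cone, read on determinants: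
    by Cramer's rule the coefficients of [x] on [v_j] and [v_k] are
    [D(x, v_k)] and [D(v_j, x)] divided by [D(v_j, v_k)]. *)
Lemma cone2P (R : realType) (n : nat) (v : 'I_n -> 'rV[R]_2) (I : {set 'I_n})
    (j k : 'I_n) (x : 'rV[R]_2) :
  0 < det2 (v j) (v k) -> I \subset [set j; k]%SET ->
  cone v I x <->
  [/\ 0 <= det2 x (v k), 0 <= det2 (v j) x,
      j \notin I -> det2 x (v k) = 0 & k \notin I -> det2 (v j) x = 0].
Proof.
move=> jk0 Ijk.
have jk : j != k.
  by apply: contraTneq jk0 => ->; rewrite det2xx ltxx.
split=> [[a a0 ->]|[xk jx jI kI]].
  rewrite (sum_sub2 _ jk Ijk).
  have -> : (if j \in I then a j *: v j else 0) =
      (if j \in I then a j else 0) *: v j by case: ifP; rewrite ?scale0r.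
  have -> : (if k \in I then a k *: v k else 0) =
      (if k \in I then a k else 0) *: v k by case: ifP; rewrite ?scale0r.
  rewrite !det2_comb; split.
  - by rewrite mulr_ge0 ?(ltW jk0)//; case: ifP.
  - by rewrite mulr_ge0 ?(ltW jk0)//; case: ifP.
  - by move=> /negPf->; rewrite mul0r.
  - by move=> /negPf->; rewrite mul0r.
set D := det2 (v j) (v k) in jk0.
exists (fun i => (if i == j then det2 x (v k) else if i == k then det2 (v j) x else 0) / D).
  by move=> i; rewrite divr_ge0 ?(ltW jk0)//; case: ifP => // _; case: ifP.
rewrite (sum_sub2 _ jk Ijk) eqxx eq_sym (negPf jk) eqxx.
transitivity (D^-1 *: (D *: x)); first by rewrite scalerA mulVf ?scale1r// gt_eqF.
rewrite (det2_cramer _ _ _ : D *: x = _) scalerDr !scalerA ![D^-1 * _]mulrC.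
congr (_ + _); case: ifPn => //.
  by move=> /jI ->; rewrite mul0r scale0r.
by move=> /kI ->; rewrite mul0r scale0r.
Qed.

(** * Fans with cyclic combinatorial type, through determinants *)

(** The rays turn counterclockwise, once around the origin: the second clause
    puts [v_i] outside the closed sector from [v_j] to [v_(j+1)], which is what
    excludes several turns. *)
Definition ccw (R : realType) (n : nat) (v : 'I_n -> 'rV[R]_2) : Prop :=
  (forall j, 0 < det2 (v j) (v (ordS j))) /\
  (forall i j, i != j -> i != ordS j ->
     det2 (v j) (v i) < 0 \/ det2 (v i) (v (ordS j)) < 0).

Lemma ordS_neq (n : nat) (j : 'I_n) : (1 < n)%N -> ordS j != j.
Proof.
move=> n1; apply/eqP => /(congr1 val)/=.
have := ltn_ord j; rewrite leq_eqVlt => /orP[/eqP jn|jn].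
  by rewrite jn modnn => j0; rewrite -j0 in jn; rewrite -jn in n1.
by rewrite modn_small// => /eqP; rewrite gtn_eqF.
Qed.

Lemma ordSS_neq (n : nat) (j : 'I_n) : (2 < n)%N -> ordS (ordS j) != j.
Proof.
move=> n2; apply/eqP => /(congr1 val)/=.
have := ltn_ord j; rewrite leq_eqVlt => /orP[/eqP jn|jn].
  rewrite jn modnn modn_small; last exact: (ltn_trans _ n2).
  by move=> j1; rewrite -j1 in jn; rewrite -jn in n2.
rewrite (modn_small jn).
move: jn; rewrite leq_eqVlt => /orP[/eqP jn|jn].
  by rewrite jn modnn => j1; rewrite -j1 in jn; rewrite -jn in n2.
rewrite modn_small// => /eqP; rewrite gtn_eqF//; exact: ltnW.
Qed.

Lemma cycle_typeP (n : nat) (I : {set 'I_n}) :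
  reflect (exists j : 'I_n, I \subset [set j; ordS j]%SET) (I \in cycle_type n).
Proof. by rewrite !inE; apply: (iffP existsP). Qed.

Lemma cycle_typeS (n : nat) (I J : {set 'I_n}) :
  I \subset J -> J \in cycle_type n -> I \in cycle_type n.
Proof.
move=> IJ /cycle_typeP[j Jj]; apply/cycle_typeP; exists j.
exact: fintype.subset_trans IJ Jj.
Qed.

Section ccw_fan.
Context (R : realType) (n : nat) (n2 : (2 < n)%N) (v : 'I_n -> 'rV[R]_2)
  (vccw : ccw v).

Let v0 j : 0 < det2 (v j) (v (ordS j)) := vccw.1 j.

Let mem_pair i j : 0 <= det2 (v j) (v i) -> 0 <= det2 (v i) (v (ordS j)) ->
  i = j \/ i = ordS j.
Proof.
move=> ji ij; have [->|ne] := eqVneq i j; first by left.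
have [->|ne'] := eqVneq i (ordS j); first by right.
by have [] := vccw.2 i j ne ne'; rewrite ltNge ?ji ?ij.
Qed.

(** Suppose that [v_k] comes after [v_j], up to exchanging [j] and [k].  Going
    counterclockwise from [v_j], one reaches [v_k] and then [x], which is still
    in the sector of [j]; so [v_k] is in this sector.  The only exception is
    [x] on the ray of [v_j], and then [v_j] is in the sector of [k]. *)
Lemma ccw_overlap (j k : 'I_n) (x : 'rV[R]_2) : x != 0 -> j != k ->
  0 <= det2 (v j) x -> 0 <= det2 x (v (ordS j)) ->
  0 <= det2 (v k) x -> 0 <= det2 x (v (ordS k)) ->
  k = ordS j \/ j = ordS k.
Proof.
move=> x0; wlog jk0 : j k / 0 <= det2 (v j) (v k).
  move=> W jk jx xj kx xk; have [/W|/ltW] := leP 0 (det2 (v j) (v k)); first exact.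
  rewrite det2C oppr_le0 => /W; rewrite eq_sym jk => /(_ isT kx xk jx xj).
  by case; [right|left].
move=> jk jx xj kx xk; have := v0 j.
set a := v j in jk0 jx *; set b := v (ordS j) in xj *.
set c := v k in jk0 kx *; set d := v (ordS k) in xk *.
move=> ab.
move: jx; rewrite le_eqVlt => /orP[/eqP ax|ax].
  have xb : 0 < det2 x b.
    rewrite lt_neqAle xj andbT eq_sym; apply: contra x0 => /eqP xb.
    by apply/eqP/(@det2_eq0 _ a b) => //; rewrite gt_eqF.
  (* x is a positive multiple of a, so determinants with x and with a are
     proportional *)
  have xE y : det2 a b * det2 x y = det2 x b * det2 a y.
    rewrite -[RHS]addr0 -[X in _ + X](mul0r (det2 b y)) ax /det2; ring.
  have xE' y : det2 a b * det2 y x = det2 x b * det2 y a.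
    by rewrite (det2C y x) (det2C y a) !mulrN xE.
  have [] := @mem_pair j k; rewrite -/a -/c -/d.
  - by rewrite -(pmulr_rge0 _ xb) -xE' mulr_ge0 // ltW.
  - by rewrite -(pmulr_rge0 _ xb) -xE mulr_ge0 // ltW.
  - by move=> E; rewrite E eqxx in jk.
  - by right.
have [] := @mem_pair k j; rewrite -/a -/b -/c => //.
- rewrite -(pmulr_rge0 _ ax).
  (* the Pluecker relation between a, b, c and x *)
  have -> : det2 a x * det2 c b = det2 a c * det2 x b + det2 c x * det2 a b.
    rewrite /det2; ring.
  by rewrite addr_ge0// mulr_ge0// ltW.
- by move=> E; rewrite E eqxx in jk.
- by left.
Qed.

(** The supporting form is a combination of [D(., v_(j+1))] and [D(v_j, .)],
    which vanish on one generator and are positive on the other: each of them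
    is included when the generator on which it is positive is outside [J]. *)
Lemma ccw_cone_subset (I J : {set 'I_n}) :
  I \in cycle_type n -> J \subset I -> is_face (cone v J) (cone v I).
Proof.
move=> /cycle_typeP[j Ij] JI.
pose u : 'cV[R]_2 := \col_k
  (if k == 0 then (j \notin J)%:R * v (ordS j) 0 1 - (ordS j \notin J)%:R * v j 0 1
   else (ordS j \notin J)%:R * v j 0 0 - (j \notin J)%:R * v (ordS j) 0 0).
have uE x : (x *m u) 0 0 =
    (j \notin J)%:R * det2 x (v (ordS j)) + (ordS j \notin J)%:R * det2 (v j) x.
  rewrite mxE big_ord_recl big_ord1 !mxE /= /det2.
  have -> : lift ord0 ord0 = 1 :> 'I_2 by apply/val_inj.
  have -> : ord0 = 0 :> 'I_2 by apply/val_inj.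
  ring.
have u0 i : i \in I -> 0 <= (v i *m u) 0 0.
  move=> /(fintype.subsetP Ij); rewrite uE !inE => /orP[] /eqP->.
    by rewrite det2xx mulr0 addr0 mulr_ge0// ltW.
  rewrite det2xx mulr0 add0r.
  by rewrite mulr_ge0// ltW.
exists u.
  move=> x /(cone2P _ (v0 j) Ij)[xj jx _ _].
  by rewrite uE addr_ge0// mulr_ge0.
rewrite cone_ker//; congr cone; apply/finset.setP => i; rewrite !inE.
have [iI|iI] /= := boolP (i \in I); last first.
  by apply/negbTE; apply: contra iI; apply: (fintype.subsetP JI).
move: iI => /(fintype.subsetP Ij); rewrite uE !inE => /orP[] /eqP->.
  rewrite det2xx mulr0 addr0 mulf_eq0.
  by rewrite (gt_eqF (v0 j)) orbF pnatr_eq0 eqb0 negbK.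
rewrite det2xx mulr0 add0r mulf_eq0.
by rewrite (gt_eqF (v0 j)) orbF pnatr_eq0 eqb0 negbK.
Qed.

(** A nonzero vector common to consecutive sectors is on the ray of
    [v_(j+1)], so its expression in either cone uses exactly that generator. *)
Lemma ccw_coneI_adj (j : 'I_n) (I J : {set 'I_n}) :
  I \subset [set j; ordS j]%SET -> J \subset [set ordS j; ordS (ordS j)]%SET ->
  cone v I `&` cone v J `<=` cone v (I :&: J)%SET.
Proof.
move=> Ij Jk x [/(cone2P _ (v0 j) Ij)[xj jx jI kI] ].
move=> /(cone2P _ (v0 (ordS j)) Jk)[xk kx kJ lJ].
have [->|x0] := eqVneq x 0; first exact: cone0.
have xk0 : det2 x (v (ordS j)) = 0.
  by apply: le_anti; rewrite xj andbT det2C oppr_le0.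
have kI' : ordS j \in I.
  apply: contraNT x0 => /kI jx0.
  by apply/eqP/(@det2_eq0 _ (v j) (v (ordS j))) => //; rewrite gt_eqF.
have kJ' : ordS j \in J.
  apply: contraNT x0 => /kJ jx0.
  apply/eqP/(@det2_eq0 _ (v (ordS j)) (v (ordS (ordS j)))) => //.
    by rewrite gt_eqF.
  by rewrite det2C xk0 oppr0.
have IJj := fintype.subset_trans (finset.subsetIl I J) Ij.
apply/(cone2P _ (v0 j) IJj).
by split=> //; rewrite inE ?kI' ?kJ' ?andbT.
Qed.

Lemma ccw_coneI (I J : {set 'I_n}) :
  I \in cycle_type n -> J \in cycle_type n ->
  cone v I `&` cone v J = cone v (I :&: J)%SET.
Proof.
move=> /cycle_typeP[j Ij] /cycle_typeP[k Jk]; apply/seteqP; split; last first.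
  move=> x xIJ; split; apply: coneS xIJ; [exact: finset.subsetIl|exact: finset.subsetIr].
move=> x xIJ; have [xI xJ] := xIJ.
have [->|x0] := eqVneq x 0; first exact: cone0.
have [xj jx jI SjI] := (cone2P x (v0 j) Ij).1 xI.
have [xk kx kJ SkJ] := (cone2P x (v0 k) Jk).1 xJ.
have [jk|jk] := eqVneq j k.
  rewrite -{}jk in kJ SkJ.
  have IJj := fintype.subset_trans (finset.subsetIl I J) Ij.
  apply/(cone2P x (v0 j) IJj).
  by split=> //; rewrite inE negb_and => /orP[].
have [kE|jE] := ccw_overlap x0 jk jx xj kx xk.
  by rewrite kE in Jk; exact: (ccw_coneI_adj Ij Jk).
by rewrite jE in Ij; rewrite finset.setIC; apply: (ccw_coneI_adj Jk Ij).
Qed.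

Lemma ccw_comb_type :
  has_combinatorial_type (generated_cones v (cycle_type n)) v (cycle_type n).
Proof.
move=> I; split=> [[J /= /cycle_typeP[j Jj] JI]|IC]; last by exists I.
apply/cycle_typeP; exists j; apply/fintype.subsetP => i iI.
have := cone_gen v iI; rewrite -JI => /(cone2P _ (v0 j) Jj)[ij ji _ _].
by have [->|->] := mem_pair ji ij; rewrite !inE eqxx ?orbT.
Qed.

Lemma ccw_is_fan : is_fan (generated_cones v (cycle_type n)).
Proof.
split.
- exact/finite_image/finite_finset.
- exists (cone v finset.set0); exists finset.set0 => //=.
  apply/cycle_typeP; exists (Ordinal (ltn_trans (ltn0Sn 1) n2)).
  exact: finset.sub0set.
- move=> _ [I /= /cycle_typeP[j Ij] <-]; split.
    exact: polyhedral_cone_cone.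
  move=> x /(cone2P _ (v0 j) Ij)[xj jx _ _] /(cone2P _ (v0 j) Ij)[xj' jx' _ _].
  have E1 : det2 (v j) (- x) = - det2 (v j) x by rewrite /det2 !mxE; ring.
  have E2 : det2 (- x) (v (ordS j)) = - det2 x (v (ordS j)).
    by rewrite /det2 !mxE; ring.
  apply/(@det2_eq0 _ (v j) (v (ordS j))); first by rewrite gt_eqF.
  + by apply: le_anti; rewrite jx andbT -oppr_ge0 -E1.
  + by apply: le_anti; rewrite xj andbT -oppr_ge0 -E2.
- move=> _ t [I /= IC <-] /cone_face[J JI ->].
  by exists J => //=; apply: cycle_typeS IC.
- move=> _ _ [I /= IC <-] [J /= JC <-]; rewrite ccw_coneI//; split.
    by apply: ccw_cone_subset => //; apply: finset.subsetIl.
  by apply: ccw_cone_subset => //; apply: finset.subsetIr.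
Qed.

End ccw_fan.

(** Adjoining [v_i] to the generators does not change the cone, so
    [{i, j, j+1}] is in the combinatorial type, whose members have at most two
    elements. *)
Lemma cone_in_cycle_type (R : realType) (n : nat) (v : 'I_n -> 'rV[R]_2)
    (i j : 'I_n) : (2 < n)%N ->
  has_combinatorial_type (generated_cones v (cycle_type n)) v (cycle_type n) ->
  cone v [set j; ordS j]%SET (v i) -> i = j \/ i = ordS j.
Proof.
move=> n2 vC ijj.
have : (i |: [set j; ordS j])%SET \in cycle_type n.
  apply/(vC _).1; exists [set j; ordS j]%SET => /=.
    by apply/cycle_typeP; exists j.
  apply/seteqP; split; first exact/coneS/finset.subsetUr.
  by apply: cone_sub => k; rewrite !inE => /orP[/eqP->//|kj]; apply: cone_gen; rewrite !inE.
move=> /cycle_typeP[k /fintype.subset_leq_card]; rewrite finset.cardsU1 !finset.cards2.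
rewrite [j == _]eq_sym [k == _]eq_sym !ordS_neq ?(ltnW n2)// !inE negb_or.
case: eqVneq => [->|_]; first by left.
by case: eqVneq => [->|_]; first by right.
Qed.

(** The positivity of [D(v_j, v_(j+1))] goes from [j] to [j+1]: if the next
    determinant were negative, then [v_j] and [v_(j+2)] would be on the same
    side of [v_(j+1)], and the ray closer to [v_(j+1)] would be in the cone of
    the other one and [v_(j+1)]. *)
Lemma ccw_of_fan (R : realType) (n : nat) (v : 'I_n -> 'rV[R]_2) :
  (2 < n)%N -> (forall j : 'I_n, j = 0 :> nat -> 0 < det2 (v j) (v (ordS j))) ->
  is_fan (generated_cones v (cycle_type n)) ->
  has_combinatorial_type (generated_cones v (cycle_type n)) v (cycle_type n) ->
  ccw v.
Proof.
move=> n2 v01 [_ _ vS _ _] vC.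
have mem_pair i j : 0 < det2 (v j) (v (ordS j)) ->
    0 <= det2 (v j) (v i) -> 0 <= det2 (v i) (v (ordS j)) -> i = j \/ i = ordS j.
  move=> jj ji ij; apply: (cone_in_cycle_type n2 vC).
  apply/(cone2P _ jj) => //; split=> //; rewrite !inE eqxx ?orbT//.
have n1 := ltnW n2.
have v0 j : v j != 0.
  apply/eqP => vj0.
  have [] := @cone_in_cycle_type _ _ v j (ordS j) n2 vC.
  - rewrite vj0; exact: cone0.
  - by move=> /eqP; rewrite eq_sym (negPf (ordS_neq _ n1)).
  - by move=> /eqP; rewrite eq_sym (negPf (ordSS_neq _ n2)).
(* v_(j+1) is a multiple l of v_j; if 0 <= l it lies in the cone of j-1 and j,
   and if l < 0 the cone of j and j+1 contains a line *)
have neq0 j : det2 (v j) (v (ordS j)) != 0.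
  apply/eqP => jj0.
  have [l lj] : exists l, v (ordS j) = l *: v j.
    have := v0 j; have [j0 _|j0 _] := eqVneq (v j 0 0) 0.
      have [j1|j1] := eqVneq (v j 0 1) 0.
        by have /eqP[] := v0 j; apply: row2P; rewrite mxE.
      exists (v (ordS j) 0 1 / v j 0 1); apply: row2P; rewrite mxE; last by rewrite divfK.
      apply: (mulfI j1); move: jj0; rewrite /det2 j0 mul0r => /eqP.
      by rewrite sub0r oppr_eq0 => /eqP ->; rewrite !mulr0.
    exists (v (ordS j) 0 0 / v j 0 0); apply: row2P; rewrite mxE; first by rewrite divfK.
    apply: (mulfI j0); move/eqP: jj0; rewrite subr_eq0 => /eqP ->.
    by rewrite [RHS]mulrA [v j 0 0 * (_ / _)]mulrC divfK// mulrC.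
  have jjC : generated_cones v (cycle_type n) (cone v [set j; ordS j]%SET).
    by exists [set j; ordS j]%SET => //=; apply/cycle_typeP; exists j.
  have [l0|l0] := leP 0 l.
    have [i ij] : exists i, ordS i = j by exists (ord_pred j); rewrite ord_predK.
    have [] := @cone_in_cycle_type _ _ v (ordS j) i n2 vC.
    + rewrite lj; have : cone v [set i; ordS i]%SET (v j).
        by apply: cone_gen; rewrite ij !inE eqxx orbT.
      case=> a a0 ->; exists (fun k => l * a k) => [k|]; first exact: mulr_ge0.
      by rewrite scaler_sumr; apply: eq_bigr => k _; rewrite scalerA.
    + by rewrite -ij => /eqP; rewrite (negPf (ordSS_neq _ n2)).
    + by rewrite -ij => /ordS_inj/eqP; rewrite (negPf (ordS_neq _ n1)).
  have /eqP[] := v0 j; apply: (vS _ jjC).2; first by apply: cone_gen; rewrite !inE eqxx.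
  have : cone v [set j; ordS j]%SET (v (ordS j)) by apply: cone_gen; rewrite !inE eqxx orbT.
  have -> : - v j = (- l^-1) *: v (ordS j).
    by rewrite lj scalerA mulNr mulVf ?scaleN1r// lt_eqF.
  case=> a a0 ->; exists (fun k => - l^-1 * a k) => [k|].
    by rewrite mulr_ge0// oppr_ge0 invr_le0 ltW.
  by rewrite scaler_sumr; apply: eq_bigr => k _; rewrite scalerA.
have step j : 0 < det2 (v j) (v (ordS j)) ->
    0 < det2 (v (ordS j)) (v (ordS (ordS j))).
  move=> ab; rewrite lt_neqAle eq_sym neq0 /= leNgt; apply/negP => bc.
  have cb : 0 < det2 (v (ordS (ordS j))) (v (ordS j)) by rewrite det2C oppr_gt0.
  have [ac|ca] := leP 0 (det2 (v j) (v (ordS (ordS j)))).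
    have [/eqP|/ordS_inj/eqP] := mem_pair _ _ ab ac (ltW cb).
      by rewrite (negPf (ordSS_neq _ n2)).
    by rewrite (negPf (ordS_neq _ n1)).
  have [] := @cone_in_cycle_type _ _ v j (ordS j) n2 vC.
  - rewrite finset.setUC; apply/(cone2P _ cb) => //.
    by split; rewrite ?(ltW ab)// ?inE ?eqxx ?orbT// det2C oppr_ge0 ltW.
  - by move=> /eqP; rewrite eq_sym (negPf (ordS_neq _ n1)).
  - by move=> /eqP; rewrite eq_sym (negPf (ordSS_neq _ n2)).
have v1 j : 0 < det2 (v j) (v (ordS j)).
  case: j => j; elim: j => [|j IH] jn; first exact: v01.
  have := step _ (IH (ltnW jn)); congr (_ < det2 (v _) (v (ordS _))).
    by apply/val_inj; rewrite /= modn_small.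
  by apply/val_inj; rewrite /= modn_small.
split=> // i j ij iSj.
have [ji|] := leP 0 (det2 (v j) (v i)); last by left.
have [ij'|] := leP 0 (det2 (v i) (v (ordS j))); last by right.
by have [E|E] := mem_pair i j (v1 j) ji ij'; [rewrite E eqxx in ij|rewrite E eqxx in iSj].
Qed.

(** * Half-angle coordinates *)

(** A vector of angle [theta] in the open interval from [0] to [2 pi] is
    encoded by [t = cot (theta / 2)] and a positive scale [r]; the scale is
    normalized so that [e_2] has coordinates [(1, 1)]. *)
Definition half_angle_vec (R : realType) (r t : R) : 'rV[R]_2 :=
  \row_k (if k == 0 then r * (t ^+ 2 - 1) / 2 else r * t).

Definition half_angle_rad (R : realType) (x : 'rV[R]_2) : R :=
  Num.sqrt (x 0 0 ^+ 2 + x 0 1 ^+ 2) - x 0 0.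

(** The half-angle formula [cot (theta / 2) = sin theta / (1 - cos theta)]. *)
Definition half_angle_cot (R : realType) (x : 'rV[R]_2) : R :=
  x 0 1 / half_angle_rad x.

Lemma half_angle_rad_gt0 (R : realType) (x : 'rV[R]_2) :
  x 0 0 < 0 \/ x 0 1 != 0 -> 0 < half_angle_rad x.
Proof.
rewrite /half_angle_rad subr_gt0 => x01; have [x0|x0] := ltP (x 0 0) 0.
  by rewrite (lt_le_trans x0)// sqrtr_ge0.
case: x01 => [|x1]; first by rewrite ltNge x0.
have x1gt0 : 0 < x 0 1 ^+ 2 by rewrite exprn_even_gt0.
rewrite -{1}(ger0_norm x0) -sqrtr_sqr ltr_sqrt; last first.
  by rewrite ltr_wpDl// sqr_ge0.
by rewrite ltrDl.
Qed.

Lemma half_angleK (R : realType) (x : 'rV[R]_2) : 0 < half_angle_rad x ->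
  half_angle_vec (half_angle_rad x) (half_angle_cot x) = x.
Proof.
move=> r0; apply: row2P; rewrite !mxE/=; last by rewrite mulrC divfK ?gt_eqF.
have := sqr_sqrtr (addr_ge0 (sqr_ge0 (x 0 0)) (sqr_ge0 (x 0 1))).
move: r0; rewrite /half_angle_cot /half_angle_rad.
set s := Num.sqrt _ => r0 sE.
have r0' : s - x 0 0 != 0 by rewrite gt_eqF.
apply: (mulfI r0').
have -> : (s - x 0 0) * ((s - x 0 0) * ((x 0 1 / (s - x 0 0)) ^+ 2 - 1) / 2) =
  (x 0 1 ^+ 2 - (s - x 0 0) ^+ 2) / 2 by field.
have -> : x 0 1 ^+ 2 = s ^+ 2 - x 0 0 ^+ 2 by rewrite sE; ring.
by field.
Qed.

(** Up to a positive factor this is [sin (theta' - theta)], where [theta] and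
    [theta'] are the angles of the two vectors: the factor [t - s] has
    the sign of [theta' - theta], and [t s + 1] is positive exactly when the
    angles differ by less than a half-turn. *)
Lemma det2_half_angle (R : realType) (r t q s : R) :
  det2 (half_angle_vec r t) (half_angle_vec q s) =
  (r * q / 2) * ((t - s) * (t * s + 1)).
Proof. by rewrite /det2 !mxE/=; field. Qed.

Lemma det2_e1_half_angle (R : realType) (r t : R) :
  det2 (delta_mx 0 0) (half_angle_vec r t) = r * t.
Proof. by rewrite /det2 !mxE/=; ring. Qed.

Lemma det2_half_angle_e1 (R : realType) (r t : R) :
  det2 (half_angle_vec r t) (delta_mx 0 0) = - (r * t).
Proof. by rewrite det2C det2_e1_half_angle. Qed.

(** The form taken by [ccw] in half-angle coordinates.  The indices
    start at 1 because [v_0 = e_1] has no such coordinates. *)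
Definition cot_chain (R : realType) (n : nat) (t : nat -> R) : Prop :=
  [/\ 0 < t 1%N,
      forall k, (0 < k)%N -> (k.+1 < n)%N -> t k.+1 < t k /\ -1 < t k * t k.+1 &
      t n.-1 < 0].

Lemma cot_chain_decr (R : realType) (n : nat) (t : nat -> R) :
  cot_chain n t ->
  forall i j, (0 < i)%N -> (i < j)%N -> (j < n)%N -> t j < t i.
Proof.
move=> [_ tS _] i j i0; elim: j => // j IH; rewrite ltnS leq_eqVlt => /orP[/eqP<-|ij] jn.
  by have [] := tS i i0 jn.
apply: lt_trans (IH ij (ltnW jn)).
by have [] := tS j (ltn_trans i0 ij) jn.
Qed.

Lemma ordS_val (n : nat) (i : 'I_n) :
  (ordS i = i.+1 :> nat /\ (i.+1 < n)%N) \/ (ordS i = 0 :> nat /\ i.+1 = n).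
Proof.
have := ltn_ord i; rewrite leq_eqVlt => /orP[/eqP E|ln] /=.
  by right; rewrite E modnn.
by left; rewrite modn_small.
Qed.

(** The sign of [D(v_j, v_(j+1))] leaves two cases: [t_j > t_(j+1)] with
    [t_j t_(j+1) > -1], or both inequalities reversed.  In the second case
    [t_j < 0 < t_(j+1)], which means that [e_1] is in the sector of [j].
    Conversely, once the [t_i] decrease, whether [v_i] precedes or follows
    the sector of [j] is decided by comparing [i] with [j], and then one of
    the two determinants is negative, according to whether the angle between
    [v_i] and the sector is more than a half-turn. *)
Lemma ccw_cot_chain (R : realType) (n : nat) (v : 'I_n -> 'rV[R]_2)
    (r t : nat -> R) : (2 < n)%N ->
  (forall i : 'I_n, i = 0 :> nat -> v i = delta_mx 0 0) ->
  (forall i : 'I_n, (0 < i)%N -> 0 < r i /\ v i = half_angle_vec (r i) (t i)) ->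
  ccw v <-> cot_chain n t.
Proof.
move=> n2 v0 vS.
have n0 := ltn_trans (ltn0Sn 1) n2.
have det_pos (i j : 'I_n) : (0 < i)%N -> (0 < j)%N ->
    exists2 c : R, 0 < c & det2 (v i) (v j) = c * ((t i - t j) * (t i * t j + 1)).
  move=> i0 j0; have [ri ->] := vS i i0; have [rj ->] := vS j j0.
  by exists (r i * r j / 2); [rewrite divr_gt0 ?mulr_gt0|exact: det2_half_angle].
have det_l (i j : 'I_n) : i = 0 :> nat -> (0 < j)%N ->
    exists2 c : R, 0 < c & det2 (v i) (v j) = c * t j.
  move=> /v0-> j0; have [rj ->] := vS j j0.
  by exists (r j) => //; exact: det2_e1_half_angle.
have det_r (i j : 'I_n) : (0 < i)%N -> j = 0 :> nat ->
    exists2 c : R, 0 < c & det2 (v i) (v j) = c * - t i.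
  move=> i0 /v0->; have [ri ->] := vS i i0.
  by exists (r i) => //; rewrite mulrN; exact: det2_half_angle_e1.
split.
- move=> [vpos vout]; split.
  + have [[jS _]|[_ E]] := ordS_val (Ordinal n0); last by rewrite -E in n2.
    have := vpos (Ordinal n0).
    have [//||c c0 ->] := det_l (Ordinal n0) (ordS (Ordinal n0)); first by rewrite jS.
    by rewrite pmulr_rgt0// jS.
  + move=> k k0 kn; pose j := Ordinal (ltnW kn).
    have [[jS _]|[_ E]] := ordS_val j; last by move: (kn); rewrite -[X in (_ < X)%N]E /= ltnn.
    have := vpos j.
    have [//||c c0 ->] := det_pos j (ordS j); first by rewrite jS.
    rewrite pmulr_rgt0// jS /= => D.
    have : 0 < t k \/ t k.+1 < 0.
      have [|||] := vout (Ordinal n0) j.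
      * by rewrite -val_eqE /= eq_sym -lt0n.
      * by apply/eqP => /(congr1 (@nat_of_ord n)); rewrite jS.
      * have [//|//|d d0 ->] := det_r j (Ordinal n0).
        by rewrite pmulr_rlt0// oppr_lt0; left.
      * have [//||d d0 ->] := det_l (Ordinal n0) (ordS j); first by rewrite jS.
        by rewrite pmulr_rlt0// jS; right.
    have [tt|tt] := ltP (t k.+1) (t k).
      by move=> _; split => //; move: D; rewrite pmulr_rgt0 ?subr_gt0// => D; lra.
    move: D tt; set a := t k; set b := t k.+1 => D ab ab0; exfalso.
    have p : 0 <= a * b by clear -ab ab0; case: ab0 => ab0; nra.
    clear -D p ab; nra.
  + have n1 : (n.-1 < n)%N by rewrite prednK.
    have [[_]|[jS _]] := ordS_val (Ordinal n1); first by rewrite /= prednK ?ltnn.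
    have := vpos (Ordinal n1).
    have [|//|c c0 ->] := det_r (Ordinal n1) (ordS (Ordinal n1)).
      by rewrite /= -ltnS prednK// ltnW.
    by rewrite pmulr_rgt0// oppr_gt0.
- move=> tc; have dec := cot_chain_decr tc; case: (tc) => t1 tS tn; split.
  + move=> j; have [[jS jn]|[jS jn]] := ordS_val j.
      have [j0|j0] := posnP j.
        have [//||c c0 ->] := det_l j (ordS j); first by rewrite jS.
        by rewrite pmulr_rgt0// jS j0.
      have [//||c c0 ->] := det_pos j (ordS j); first by rewrite jS.
      have [d e] := tS _ j0 jn.
      rewrite pmulr_rgt0// jS mulr_gt0//; lra.
    have [||c c0 ->] := det_r j (ordS j) => //.
      by rewrite -ltnS jn ltnW.
    by rewrite pmulr_rgt0// oppr_gt0 -[nat_of_ord j]/(j.+1.-1) jn.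
  + move=> i j ij' iSj'.
    have ij : i <> j :> nat by move=> /val_inj/eqP; rewrite (negPf ij').
    have iSj : i <> ordS j :> nat by move=> /val_inj/eqP; rewrite (negPf iSj').
    have [[jS jn]|[jS jn]] := ordS_val j; last first.
      have i0 : (0 < i)%N by rewrite lt0n; apply/eqP => i0; apply: iSj; rewrite i0 jS.
      have j0 : (0 < j)%N by rewrite -ltnS jn ltnW.
      have [//|//|c c0 ->] := det_pos j i.
      have [//|//|d d0 ->] := det_r i (ordS j).
      rewrite (pmulr_rlt0 _ c0) (pmulr_rlt0 _ d0) oppr_lt0.
      have tij : t j < t i.
        apply: dec => //; rewrite ltn_neqAle; apply/andP; split; first exact/eqP.
        by rewrite -ltnS jn.
      have tj : t j < 0 by rewrite -[nat_of_ord j]/(j.+1.-1) jn.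
      have [ti|ti] := ltP 0 (t i); [by right|left].
      rewrite nmulr_rlt0 ?subr_lt0// ltr_wpDl// mulr_le0// ltW//.
    have [j0|j0] := posnP j.
      have i0 : (0 < i)%N by rewrite lt0n; apply/eqP => i0; apply: ij; rewrite i0 j0.
      have [//|//|c c0 ->] := det_l j i.
      have [//||d d0 ->] := det_pos i (ordS j); first by rewrite jS.
      rewrite (pmulr_rlt0 _ c0) (pmulr_rlt0 _ d0) jS j0.
      have ti : t i < t 1%N.
        apply: dec => //; rewrite ltn_neqAle i0 andbT; apply/eqP => E.
        by apply: iSj; rewrite -E jS j0.
      have [ti0|ti0] := ltP (t i) 0; [by left|right].
      by rewrite nmulr_rlt0 ?subr_lt0// ltr_wpDl// mulr_ge0// ltW.
    have [tj tjj] := tS _ j0 jn.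
    have [i0|i0] := posnP i.
      have [//|//|c c0 ->] := det_r j i.
      have [//||d d0 ->] := det_l i (ordS j); first by rewrite jS.
      rewrite (pmulr_rlt0 _ c0) (pmulr_rlt0 _ d0) jS oppr_lt0.
      have [tj0|tj0] := ltP 0 (t j); [by left|right]; lra.
    have [//|//|c c0 ->] := det_pos j i.
    have [//||d d0 ->] := det_pos i (ordS j); first by rewrite jS.
    rewrite (pmulr_rlt0 _ c0) (pmulr_rlt0 _ d0) jS.
    have [lij|lji] := ltnP i j.
      have tij : t j < t i by apply: dec.
      have tSi := lt_trans tj tij.
      have [p|p] := ltP (-1) (t j * t i); [left|right].
        by rewrite nmulr_rlt0 ?subr_lt0// -ltrBlDr sub0r.
      rewrite pmulr_rlt0 ?subr_gt0//.
      have ti0 : 0 < t i by clear -tij p; nra.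
      by clear -ti0 p tj; nra.
    have tij : t i < t j.+1.
      apply: dec => //; rewrite ltn_neqAle; apply/andP; split.
        by apply/eqP => E; apply: iSj; rewrite jS.
      by rewrite ltn_neqAle lji andbT; apply/eqP => E; apply: ij.
    have tji := lt_trans tij tj.
    have [p|p] := ltP (-1) (t i * t j.+1); [right|left].
      by rewrite nmulr_rlt0 ?subr_lt0// -ltrBlDr sub0r.
    rewrite pmulr_rlt0 ?subr_gt0//.
    have ti0 : t i < 0 by clear -tij p; nra.
    by clear -ti0 p tj; nra.
Qed.

(** * Contraction *)

Lemma interpolate_lt (R : realType) (l a b c d : R) :
  0 <= l -> l <= 1 -> a < b -> c < d ->
  (1 - l) * a + l * c < (1 - l) * b + l * d.
Proof.
rewrite le_eqVlt => /orP[/eqP<- _ ab _|l0]; first lra.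
move=> l1 ab cd; apply: ler_ltD; last by rewrite ltr_pM2l.
by rewrite ler_wpM2l ?subr_ge0// ltW.
Qed.

(** The region [a b > -1] is bounded by a hyperbola and not convex; the
    bounds on the endpoints are what keeps the segment inside.  In the only
    case where the product is negative, the first factor is at most
    [(1 - l) a], and expanding leaves
    [(1 - l)^2 (a b) + l (1 - l) (a d) > - (1 - l)^2 - l (1 - l) >= -1]. *)
Lemma interpolate_gtN1 (R : realType) (l a b c d : R) :
  0 <= l -> l <= 1 -> b < a -> a < 1 -> -1 < a * b ->
  -1 <= d -> d < c -> c < 0 ->
  -1 < ((1 - l) * a + l * c) * ((1 - l) * b + l * d).
Proof.
move=> l0 l1 ba a1 ab d1 dc c0.
set A := _ + _; set B := (1 - l) * b + _.
have BA : B < A by apply: interpolate_lt.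
have [A0|A0] := leP A 0.
  by rewrite (@lt_le_trans _ _ 0)// mulr_le0// ltW// (lt_le_trans BA).
have [B0|B0] := leP 0 B; first by rewrite (@lt_le_trans _ _ 0)// mulr_ge0// ltW.
have lc : l * c <= 0 by rewrite mulr_ge0_le0// ltW.
have la0 : 0 < (1 - l) * a by move: A0; rewrite /A; lra.
have l1' : 0 < 1 - l.
  by rewrite lt_neqAle subr_ge0 l1 andbT; apply: contraTneq la0 => <-; rewrite mul0r ltxx.
have a0 : 0 < a by move: la0; rewrite pmulr_rgt0.
have AB : (1 - l) * a * B <= A * B by rewrite ler_nM2r// /A; lra.
apply: lt_le_trans AB.
have -> : (1 - l) * a * B = (1 - l) ^+ 2 * (a * b) + l * (1 - l) * (a * d).
  by rewrite /B; ring.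
have ad : -1 <= a * d by nra.
have : (1 - l) ^+ 2 * -1 < (1 - l) ^+ 2 * (a * b) by rewrite ltr_pM2l// exprn_gt0.
have : l * (1 - l) * -1 <= l * (1 - l) * (a * d).
  by rewrite ler_wpM2l// mulr_ge0// ltW.
have : 0 <= l * (1 - l) by rewrite mulr_ge0// ltW.
nra.
Qed.

Lemma cot_chain_interpolate (R : realType) (n : nat) (t c : nat -> R) (l : R) :
  0 <= l -> l <= 1 -> cot_chain n t -> t 1%N = 1 -> cot_chain n c -> c 1%N = 1 ->
  (forall k, (1 < k)%N -> (k < n)%N -> -1 <= c k /\ c k < 0) ->
  cot_chain n (fun k => (1 - l) * t k + l * c k).
Proof.
move=> l0 l1 tc t1 cc c1 cN; case: (tc) => _ tS tn; case: (cc) => _ cS cn; split.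
- rewrite t1 c1; lra.
- move=> k k0 kn; have [tt tp] := tS k k0 kn; have [ct cp] := cS k k0 kn.
  split; first exact: interpolate_lt.
  move: k0; rewrite leq_eqVlt => /orP[/eqP k1|k1].
    move: tp cp; rewrite -k1 t1 c1 !mul1r => tp cp.
    have := interpolate_lt l0 l1 tp cp; lra.
  have [ck ck0] := cN k k1 (ltnW kn); have [cSk cSk0] := cN k.+1 (ltnW k1) kn.
  apply: interpolate_gtN1 => //.
  by rewrite -t1; apply: (cot_chain_decr tc) => //; exact: ltnW.
- have := interpolate_lt l0 l1 tn cn; lra.
Qed.

(** Any decreasing sequence with values strictly between -1 and 0 after the
    first one would do. *)
Definition center_cot (R : realType) (n k : nat) : R :=
  if k == 1%N then 1 else - (k.-1%:R / n%:R).

Lemma center_bound (R : realType) (n k : nat) : (1 < k)%N -> (k < n)%N ->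
  -1 <= center_cot R n k /\ center_cot R n k < 0.
Proof.
move=> k1 kn; have n0 : 0 < n%:R :> R by rewrite ltr0n; exact: ltn_trans (ltnW k1) kn.
have k0 : 0 < k.-1%:R :> R by rewrite ltr0n -ltnS prednK// ltnW.
rewrite /center_cot gtn_eqF// oppr_lt0 lerN2 ler_pdivrMr// mul1r ler_nat divr_gt0//.
by split=> //; exact: leq_trans (leq_pred _) (ltnW kn).
Qed.

Lemma cot_chain_center (R : realType) (n : nat) : (2 < n)%N ->
  cot_chain n (center_cot R n).
Proof.
move=> n2; have n0 : 0 < n%:R :> R by rewrite ltr0n (ltn_trans _ n2).
split; first by rewrite /center_cot eqxx.
- move=> k k0 kn.
  have [cSk cSk0] := @center_bound R n k.+1 k0 kn.
  move: (k0); rewrite leq_eqVlt => /orP[/eqP k1|k1].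
    rewrite -k1; rewrite -k1 in cSk0; rewrite (_ : center_cot R n 1 = 1) ?mul1r;
      last by rewrite /center_cot eqxx.
    split; first by rewrite (lt_trans cSk0).
    rewrite /center_cot/= ltrN2 ltr_pdivrMr// mul1r ltr_nat.
    exact: ltn_trans n2.
  have [ck ck0] := center_bound R k1 (ltnW kn).
  split; last by rewrite (@lt_trans _ _ 0)// ?nmulr_rgt0.
  rewrite /center_cot (gtn_eqF k1) (gtn_eqF (ltn_trans k1 (ltnSn k))).
  by rewrite ltrN2 ltr_pM2r ?invr_gt0// ltr_nat/= prednK.
- have n1 : n.-1.+1 = n by rewrite prednK// (ltn_trans _ n2).
  by apply: (center_bound R _ _).2; rewrite -ltnS n1// ltnW.
Qed.

(** * The set Omega *)

Lemma normalized_ray0 (R : realType) (n : nat) (w : 'M[R]_(n - 2, 2)) (i : 'I_n) :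
  i = 0 :> nat -> normalized_rays w i = delta_mx 0 0.
Proof. by rewrite /normalized_rays => ->. Qed.

Lemma normalized_ray1 (R : realType) (n : nat) (w : 'M[R]_(n - 2, 2)) (i : 'I_n) :
  i = 1%N :> nat -> normalized_rays w i = delta_mx 0 1.
Proof. by rewrite /normalized_rays => ->. Qed.

Lemma normalized_raySS (R : realType) (n : nat) (w : 'M[R]_(n - 2, 2)) (i : 'I_n)
    (k : 'I_(n - 2)) : i = k.+2 :> nat -> normalized_rays w i = row k w.
Proof.
rewrite /normalized_rays => -> /=.
by rewrite (nth_map k) ?size_enum_ord// nth_ord_enum.
Qed.

Variant ray_index_spec (n : nat) (i : 'I_n) : Prop :=
| RayIndex0 of i = 0 :> nat
| RayIndex1 of i = 1%N :> nat
| RayIndexSS (k : 'I_(n - 2)) of i = k.+2 :> nat.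

Lemma ray_indexP (n : nat) (i : 'I_n) : ray_index_spec i.
Proof.
case E : (nat_of_ord i) => [|[|k]]; [exact: RayIndex0|exact: RayIndex1|].
have kn : (k < n - 2)%N by rewrite ltn_subRL addnC addn2 -E.
exact: (@RayIndexSS _ _ (Ordinal kn)).
Qed.

Lemma Omega_cycleE (R : realType) (n : nat) : (2 < n)%N ->
  Omega R (cycle_type n) = [set w | ccw (normalized_rays w)].
Proof.
move=> n2; apply/seteqP; split=> w /=.
- move=> [F C]; apply: ccw_of_fan => // j j0.
  have [[jS _]|[_ jn]] := ordS_val j; last by move: (n2); rewrite -[X in (2 < X)%N]jn j0.
  rewrite (normalized_ray0 _ j0) normalized_ray1 ?jS ?j0//.
  by rewrite /det2 !mxE/= mulr1 mulr0 subr0.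
- by move=> wc; split; [exact: ccw_is_fan|exact: ccw_comb_type].
Qed.

Lemma normalized_ray_continuous (R : realType) (n : nat) (i : 'I_n) (k : 'I_2) :
  continuous (fun w : 'M[R]_(n - 2, 2) => normalized_rays w i 0 k).
Proof.
have [i0|i1|l il] := ray_indexP i.
- under eq_fun do rewrite normalized_ray0//; exact: cst_continuous.
- under eq_fun do rewrite normalized_ray1//; exact: cst_continuous.
- under eq_fun do rewrite (normalized_raySS _ il) mxE; exact: coord_continuous.
Qed.

(** A finite intersection of unions of strict polynomial inequalities. *)
Lemma open_Omega_cycle (R : realType) (n : nat) : (2 < n)%N ->
  open (Omega R (cycle_type n)).
Proof.
move=> n2; rewrite Omega_cycleE//.
have dc i j : continuous (fun w : 'M[R]_(n - 2, 2) =>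
    det2 (normalized_rays w i) (normalized_rays w j)).
  move=> w; apply: (cvgB (F := nbhs w)); apply: (cvgM (F := nbhs w));
    exact: normalized_ray_continuous.
rewrite openE => w [wpos wout]; rewrite /interior/=.
have npos : \forall u \near w, forall j : 'I_n,
    0 < det2 (normalized_rays u j) (normalized_rays u (ordS j)).
  by apply: (@filter_forall _ _ _ (nbhs w)) => j; apply: (cvgr_gt _ (dc _ _ w)).
have nout : \forall u \near w, forall i j : 'I_n, i != j -> i != ordS j ->
   det2 (normalized_rays u j) (normalized_rays u i) < 0 \/
   det2 (normalized_rays u i) (normalized_rays u (ordS j)) < 0.
  apply: (@filter_forall _ _ _ (nbhs w)) => i; apply: (@filter_forall _ _ _ (nbhs w)) => j.
  have [->|ij] := eqVneq i j; first exact: nearW.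
  have [->|iSj] := eqVneq i (ordS j); first exact: nearW.
  have [h|h] := wout i j ij iSj.
    by apply: filterS (cvgr_lt _ (dc _ _ w) _ h) => u ? _ _; left.
  by apply: filterS (cvgr_lt _ (dc _ _ w) _ h) => u ? _ _; right.
by apply: filterS2 npos nout => u; split.
Qed.

(** * The contraction *)

Definition contraction (R : realType) (n : nat) (z : R * 'M[R]_(n - 2, 2)) :
    'M[R]_(n - 2, 2) :=
  \matrix_(k < n - 2) half_angle_vec
    ((1 - z.1) * half_angle_rad (row k z.2) + z.1)
    ((1 - z.1) * half_angle_cot (row k z.2) + z.1 * center_cot R n k.+2).

(** A vector off the ray of [e_1] has half-angle coordinates, and no [v_i] with
    [i > 1] is in the sector from [e_1] to [e_2]. *)
Lemma ccw_rad_gt0 (R : realType) (n : nat) (w : 'M[R]_(n - 2, 2)) (i : 'I_n) :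
  (2 < n)%N -> ccw (normalized_rays w) -> (0 < i)%N ->
  0 < half_angle_rad (normalized_rays w i).
Proof.
move=> n2 [_ wout] i0; apply: half_angle_rad_gt0.
have [i1|i1] := eqVneq (nat_of_ord i) 1%N.
  by right; rewrite normalized_ray1// mxE/= oner_eq0.
have n0 := ltn_trans (ltn0Sn 1) n2; pose o := Ordinal n0.
have [[oS _]|[_ on]] := ordS_val o; last by move: (n2); rewrite -[X in (2 < X)%N]on.
have [|||] := wout i o.
- by apply/eqP => /(congr1 (@nat_of_ord n))/= E; rewrite E in i0.
- by apply/eqP => /(congr1 (@nat_of_ord n)); rewrite oS => /eqP; rewrite (negPf i1).
- rewrite normalized_ray0// /det2 !mxE/= mul1r mul0r subr0 => wk.
  by right; rewrite lt_eqF.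
- rewrite [normalized_rays w (ordS o)]normalized_ray1// /det2 !mxE/= mulr1 mulr0 subr0.
  by left.
Qed.

Lemma normalized_raySS_ex (R : realType) (n : nat) (w : 'M[R]_(n - 2, 2))
    (k : 'I_(n - 2)) :
  exists2 i : 'I_n, i = k.+2 :> nat & normalized_rays w i = row k w.
Proof.
have kn : (k.+2 < n)%N by have := ltn_ord k; rewrite ltn_subRL addnC addn2.
by exists (Ordinal kn) => //; exact: normalized_raySS.
Qed.

Lemma ccw_row_rad_gt0 (R : realType) (n : nat) (w : 'M[R]_(n - 2, 2))
    (k : 'I_(n - 2)) :
  (2 < n)%N -> ccw (normalized_rays w) -> 0 < half_angle_rad (row k w).
Proof.
move=> n2 wc; have [i ik <-] := normalized_raySS_ex w k.
by apply: ccw_rad_gt0; rewrite ?ik.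
Qed.

Lemma half_angle_cot_e2 (R : realType) : half_angle_cot (delta_mx 0 1 : 'rV[R]_2) = 1.
Proof.
rewrite /half_angle_cot /half_angle_rad !mxE/= expr0n expr1n add0r sqrtr1 subr0.
by rewrite divr1.
Qed.

Lemma half_angle_e2 (R : realType) : half_angle_vec 1 1 = delta_mx 0 1 :> 'rV[R]_2.
Proof. by apply: row2P; rewrite !mxE/= ?expr1n ?subrr ?mulr0 ?mul0r ?mulr1. Qed.

(** The chains of half-angle coordinates are indexed by [nat], the rays by
    ['I_n]. *)
Definition ord_ext (R : realType) (n : nat) (f : 'I_n -> R) (i : nat) : R :=
  oapp f 0 (insub i).

Lemma ord_extE (R : realType) (n : nat) (f : 'I_n -> R) (i : 'I_n) :
  ord_ext f i = f i.
Proof. by rewrite /ord_ext valK. Qed.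

Definition ray_rad (R : realType) (n : nat) (w : 'M[R]_(n - 2, 2)) : nat -> R :=
  ord_ext (fun i : 'I_n => half_angle_rad (normalized_rays w i)).

Definition ray_cot (R : realType) (n : nat) (w : 'M[R]_(n - 2, 2)) : nat -> R :=
  ord_ext (fun i : 'I_n => half_angle_cot (normalized_rays w i)).

Lemma ray_radSS (R : realType) (n : nat) (w : 'M[R]_(n - 2, 2)) (k : 'I_(n - 2)) :
  ray_rad w k.+2 = half_angle_rad (row k w).
Proof. by have [i <- <-] := normalized_raySS_ex w k; rewrite /ray_rad ord_extE. Qed.

Lemma ray_cotSS (R : realType) (n : nat) (w : 'M[R]_(n - 2, 2)) (k : 'I_(n - 2)) :
  ray_cot w k.+2 = half_angle_cot (row k w).
Proof. by have [i <- <-] := normalized_raySS_ex w k; rewrite /ray_cot ord_extE. Qed.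

Lemma ray_cot1 (R : realType) (n : nat) (w : 'M[R]_(n - 2, 2)) :
  (2 < n)%N -> ray_cot w 1 = 1.
Proof.
move=> n2; rewrite -[1%N]/(nat_of_ord (Ordinal (ltnW n2))) /ray_cot ord_extE.
by rewrite normalized_ray1// half_angle_cot_e2.
Qed.

Lemma ccw_ray_cot (R : realType) (n : nat) (w : 'M[R]_(n - 2, 2)) :
  (2 < n)%N -> ccw (normalized_rays w) -> cot_chain n (ray_cot w).
Proof.
move=> n2 wc; apply/(ccw_cot_chain (v := normalized_rays w) (r := ray_rad w)) => //.
  by move=> i; exact: normalized_ray0.
move=> i i0; rewrite /ray_rad /ray_cot !ord_extE.
by have r0 := ccw_rad_gt0 n2 wc i0; rewrite half_angleK.
Qed.

Lemma cot_chain_ccw (R : realType) (n : nat) (w : 'M[R]_(n - 2, 2))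
    (r t : nat -> R) : (2 < n)%N -> t 1%N = 1 ->
  (forall k : 'I_(n - 2), 0 < r k.+2 /\ row k w = half_angle_vec (r k.+2) (t k.+2)) ->
  cot_chain n t -> ccw (normalized_rays w).
Proof.
move=> n2 t1 wS /(ccw_cot_chain (v := normalized_rays w)
  (r := fun i => if i == 1%N then 1 else r i)); apply => //.
  by move=> i; exact: normalized_ray0.
move=> i; have [->//|i1|k ik _] := ray_indexP i.
  by rewrite (normalized_ray1 _ i1) i1 t1 half_angle_e2 eqxx.
by rewrite (normalized_raySS _ ik) ik; exact: wS.
Qed.

Lemma contraction_ccw (R : realType) (n : nat) (l : R) (w : 'M[R]_(n - 2, 2)) :
  (2 < n)%N -> 0 <= l -> l <= 1 -> ccw (normalized_rays w) ->
  ccw (normalized_rays (contraction (l, w))).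
Proof.
move=> n2 l0 l1 wc.
apply: (@cot_chain_ccw _ _ _ (fun i => (1 - l) * ray_rad w i + l)
  (fun i => (1 - l) * ray_cot w i + l * center_cot R n i)) => //.
- by rewrite ray_cot1// /center_cot/=; ring.
- move=> k; rewrite ray_radSS ray_cotSS rowK; split=> //.
  have k0 := ccw_row_rad_gt0 k n2 wc.
  move: l0; rewrite le_eqVlt => /orP[/eqP<-|l0]; first by rewrite subr0 mul1r addr0.
  by rewrite ltr_wpDl// mulr_ge0// ?(ltW k0)// subr_ge0.
- apply: (@cot_chain_interpolate _ _ (ray_cot w) (center_cot R n)) => //.
  + exact: ccw_ray_cot.
  + exact: ray_cot1.
  + exact: cot_chain_center.
  + by move=> k; exact: center_bound.
Qed.

(** The coordinate [half_angle_cot] is a quotient by [half_angle_rad], so it is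
    continuous where the latter is positive. *)
Lemma contraction_continuous (R : realType) (n : nat) (z : R * 'M[R]_(n - 2, 2)) :
  (forall k, 0 < half_angle_rad (row k z.2)) ->
  {for z, continuous (@contraction R n)}.
Proof.
move=> z0.
have c1 : y.1 @[y --> z] --> z.1 by exact: cvg_fst.
have c1' : 1 - y.1 @[y --> z] --> 1 - z.1.
  by apply: (cvgB (F := nbhs z)) => //; exact: cvg_cst.
have c2 k j : row k y.2 0 j @[y --> z] --> row k z.2 0 j.
  rewrite mxE; under eq_fun do rewrite mxE.
  apply: (@continuous_comp _ _ _ snd (fun w : 'M[R]_(n - 2, 2) => w k j)).
    exact: cvg_snd.
  exact: coord_continuous.
have crad k : half_angle_rad (row k y.2) @[y --> z] --> half_angle_rad (row k z.2).
  apply: (cvgB (F := nbhs z)) => //.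
  apply: (@cvg_comp _ _ _ (fun y : R * 'M[R]_(n - 2, 2) =>
    row k y.2 0 0 ^+ 2 + row k y.2 0 1 ^+ 2) Num.sqrt); last exact: sqrt_continuous.
  by apply: (cvgD (F := nbhs z)); apply: (cvgM (F := nbhs z)).
have ccot k : half_angle_cot (row k y.2) @[y --> z] --> half_angle_cot (row k z.2).
  apply: (cvgM (F := nbhs z)) => //; apply: (cvgV (F := nbhs z)) => //.
  exact: lt0r_neq0.
pose rad k (y : R * 'M[R]_(n - 2, 2)) :=
  (1 - y.1) * half_angle_rad (row k y.2) + y.1.
pose cot k (y : R * 'M[R]_(n - 2, 2)) :=
  (1 - y.1) * half_angle_cot (row k y.2) + y.1 * center_cot R n k.+2.
have cr k : rad k y @[y --> z] --> rad k z.
  by apply: (cvgD (F := nbhs z)) => //; apply: (cvgM (F := nbhs z)).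
have ct k : cot k y @[y --> z] --> cot k z.
  apply: (cvgD (F := nbhs z)); apply: (cvgM (F := nbhs z)) => //.
  exact: cvg_cst.
have cE k j : contraction y k j @[y --> z] --> contraction z k j.
  rewrite !mxE; under eq_fun do rewrite !mxE.
  case: (j == 0); last by apply: (cvgM (F := nbhs z)); [exact: cr|exact: ct].
  apply: (cvgM (F := nbhs z)); last exact: cvg_cst.
  apply: (cvgM (F := nbhs z)); first exact: cr.
  apply: (cvgB (F := nbhs z)); last exact: cvg_cst.
  by apply: (cvgM (F := nbhs z)); exact: ct.
move=> A [P zP PA].
have : \forall y \near z, forall k j, P k j (contraction y k j).
  apply: (@filter_forall _ _ _ (nbhs z)) => k.
  by apply: (@filter_forall _ _ _ (nbhs z)) => j; exact: cE (zP k j).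
by apply: filterS => y Py; apply: PA.
Qed.

Unset Implicit Arguments.

Theorem theorem2p3p8 (R : realType) (n : nat) (hn : (3 <= n)%N) :
  open (Omega R (cycle_type n)) /\ contractible R (Omega R (cycle_type n)).
Proof.
split; first exact: open_Omega_cycle.
rewrite Omega_cycleE//.
exists (\matrix_(k < n - 2) half_angle_vec 1 (center_cot R n k.+2)) => /=.
  apply: (@cot_chain_ccw _ _ _ (fun=> 1) (center_cot R n)) => //.
  - by move=> k; rewrite rowK.
  - exact: cot_chain_center.
exists (@contraction R n); split.
- apply: continuous_in_subspaceT => -[l w]; rewrite inE => -[/= _ wc].
  by apply: contraction_continuous => k; exact: ccw_row_rad_gt0.
- move=> [l w] [/=]; rewrite in_itv/= => /andP[l0 l1] wc.
  exact: contraction_ccw.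
- move=> w wc; apply/row_matrixP => k; rewrite rowK/= subr0 !mul1r mul0r !addr0.
  by rewrite half_angleK// ccw_row_rad_gt0.
- move=> w wc; apply/row_matrixP => k.
  by rewrite !rowK/= subrr !mul0r !add0r mul1r.
Qed.
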